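(* There exist absolute constants $c\ge 1$ and $C>0$ such that for all $D,n\ge 1$, in the arrival-only model with $D$ divisible resources, there is an online allocation policy which, on every instance with $n$ arriving jobs and every monotone fair share policy $(I_d)_{d\in[D]}$, is feasible in every resource, satisfies $A_d(j,t)\ge I_d(j,t)/c$ for all $d\in[D]$, all $t$ and all alive $j$, and makes at most $C\, n D\log n$ disruptions in total. In particular, this holds for the weighted Dominant Resource Fairness (DRF) policy, whose fair shares are monotone in each resource.
   Context: Model. There are $D$ divisible resources, each with unit supply. $N^t$ denotes the set of alive jobs at time $t$; in the arrival-only model $N^{t-1}\subseteq N^t$ and one new job arrives at each time step. A fair share policy specifies ideal shares $I_d(j,t)\ge 0$ for $j\in N^t$, $d\in[D]$, with $\sum_{j\in N^t}I_d(j,t)\le 1$ for each $d$; it is monotone if for each resource $d$, whenever job $j$ arrives at time $t$, $I_d(j',t)\le I_d(j',t-1)$ for every $j'\in N^t\setminus\{j\}$. Shares at time $t$ are revealed at time $t$. Weighted DRF: job $j$ has weight $w_j>0$ and requirements $r_{jd}\ge 0$ (not all zero); running at rate $y_j$ it consumes $r_{jd}y_j$ of resource $d$. The weighted DRF allocation at time $t$ sets the rates $y_j$, $j\in N^t$, so that $\sum_{j\in N^t} r_{jd}y_j\le 1$ for all $d$ and $w_j y_j\max_d r_{jd}$ equals the same value $\lambda$ for all jobs, with $\lambda$ as large as possible (water-filling); the fair shares are $I_d(j,t)=r_{jd}y_j$. An online allocation policy chooses at each time $t$ amounts $A_d(j,t)\ge 0$ for $j\in N^t$, $d\in[D]$,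 depending only on what has been revealed up to time $t$ (the total number $n$ of jobs is assumed known a priori); it is feasible if $\sum_{j\in N^t}A_d(j,t)\le 1$ for all $d,t$. A disruption is a triple $(j,d,t)$ with $j\in N^{t-1}\cap N^t$ and $A_d(j,t)\ne A_d(j,t-1)$. *)

(* Defs.v *)
From HB Require Import structures.
From mathcomp Require Import all_boot all_order all_algebra.
From mathcomp Require Import reals exp.

Set Implicit Arguments.
Unset Strict Implicit.
Unset Printing Implicit Defensive.

Import Order.TTheory GRing.Theory Num.Theory.

Local Open Scope ring_scope.

(* Jobs are labelled by 'I_n in an arbitrary (not necessarily arrival) order;
   the time steps are 1, ..., n, and time 0 is the empty system.             *)
Definition alive_sets (n : nat) := nat -> {set 'I_n}.

Definition arrives (n : nat) (N : alive_sets n) (t : nat) (j : 'I_n) : Prop :=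
  j \notin N t.-1 /\ N t = j |: N t.-1.

Definition arrival_only (n : nat) (N : alive_sets n) : Prop :=
  N 0%N = set0 /\
  forall t : nat, (0 < t <= n)%N -> exists j : 'I_n, arrives N t j.

(* X t j d is the amount of resource d that X gives to job j at time t; it is
   meaningful only for 0 < t <= n and j \in N t.                             *)
Definition shares (R : realType) (n D : nat) := nat -> 'I_n -> 'I_D -> R.

Definition feasible (R : realType) (n D : nat) (N : alive_sets n)
    (X : shares R n D) : Prop :=
  forall t : nat, (0 < t <= n)%N ->
    (forall (j : 'I_n) (d : 'I_D), j \in N t -> 0 <= X t j d) /\
    (forall d : 'I_D, \sum_(j in N t) X t j d <= 1).

Definition monotone_shares (R : realType) (n D : nat) (N : alive_sets n)
    (I : shares R n D) : Prop :=
  forall (d : 'I_D) (t : nat) (j : 'I_n), (0 < t <= n)%N -> arrives N t j ->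
    forall j' : 'I_n, j' \in N t :\ j -> I t j' d <= I t.-1 j' d.

Definition policy (R : realType) (n D : nat) :=
  alive_sets n -> shares R n D -> shares R n D.

(* Inputs that agree on everything revealed up to time t (the alive sets and
   the ideal shares of alive jobs) get the same allocation at time t.        *)
Definition online (R : realType) (n D : nat) (P : policy R n D) : Prop :=
  forall (N N' : alive_sets n) (I I' : shares R n D) (t : nat),
    (0 < t <= n)%N ->
    (forall s : nat, (0 < s <= t)%N ->
       N s = N' s /\
       forall (j : 'I_n) (d : 'I_D), j \in N s -> I s j d = I' s j d) ->
    forall (j : 'I_n) (d : 'I_D), j \in N t -> P N I t j d = P N' I' t j d.

Definition disruptions (R : realType) (n D : nat) (N : alive_sets n)
    (A : shares R n D) : nat :=
  (\sum_(1 <= t < n.+1)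
     #|[set jd : 'I_n * 'I_D | (jd.1 \in N t.-1 :&: N t) &&
          (A t jd.1 jd.2 != A t.-1 jd.1 jd.2)]|)%N.

Definition guarantees (R : realType) (c C : R) (n D : nat) (N : alive_sets n)
    (I A : shares R n D) : Prop :=
  [/\ feasible N A,
      forall (d : 'I_D) (t : nat) (j : 'I_n), (0 < t <= n)%N -> j \in N t ->
        I t j d / c <= A t j d
    & (disruptions N A)%:R <= C * n%:R * D%:R * ln n%:R].

(* The rates y equalize the weighted dominant shares of the jobs of S at the
   level lambda. The maximum over d may start from 0 since r is nonnegative. *)
Definition drf_level (R : realType) (n D : nat) (w : 'I_n -> R)
    (r : 'I_n -> 'I_D -> R) (S : {set 'I_n}) (y : 'I_n -> R) (lambda : R) :
    Prop :=
  (forall d : 'I_D, \sum_(j in S) r j d * y j <= 1) /\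
  (forall j : 'I_n, j \in S ->
     w j * y j * \big[Num.max/0]_(d < D) r j d = lambda).

Definition weighted_drf (R : realType) (n D : nat) (w : 'I_n -> R)
    (r : 'I_n -> 'I_D -> R) (S : {set 'I_n}) (y : 'I_n -> R) : Prop :=
  exists2 lambda : R, drf_level w r S y lambda &
    forall (y' : 'I_n -> R) (lambda' : R),
      drf_level w r S y' lambda' -> lambda' <= lambda.

Definition drf_shares (R : realType) (n D : nat) (r : 'I_n -> 'I_D -> R)
    (y : nat -> 'I_n -> R) : shares R n D :=
  fun t j d => r j d * y t j.

Lemma weighted_drf_exists (R : realType) (n D : nat) (w : 'I_n -> R)
    (r : 'I_n -> 'I_D -> R) (S : {set 'I_n}) :
  (forall j : 'I_n, 0 < w j) ->
  (forall (j : 'I_n) (d : 'I_D), 0 <= r j d) ->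
  (forall j : 'I_n, exists d : 'I_D, r j d != 0) ->
  S != set0 -> exists y : 'I_n -> R, weighted_drf w r S y.
Proof.
move=> w0 r0 rN0 /set0Pn[j0 j0S].
pose m j := \big[Num.max/0]_(d < D) r j d.
have m_gt0 j : 0 < m j.
  have [d rd] := rN0 j; apply: (@lt_le_trans _ _ (r j d)).
    by rewrite lt_neqAle eq_sym rd r0.
  by rewrite /m (bigD1 d) //= le_max lexx.
pose q j := (w j * m j)^-1.
have q_gt0 j : 0 < q j by rewrite invr_gt0 mulr_gt0.
pose s d := \sum_(j in S) r j d * q j.
have s_ge0 d : 0 <= s d.
  by apply: sumr_ge0 => j _; rewrite mulr_ge0 // ltW.
have [d0 rd0] := rN0 j0.
have sd0 : 0 < s d0.
  rewrite /s (bigD1 j0) //= ltr_wpDr //.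
    by apply: sumr_ge0 => j _; rewrite mulr_ge0 // ltW.
  by rewrite mulr_gt0 // lt_neqAle eq_sym rd0 r0.
have [dm _ dmP] := @Order.TotalTheory.arg_maxP _ _ _ d0 xpredT s isT.
have sdm : 0 < s dm by apply: lt_le_trans sd0 (dmP d0 isT).
exists (fun j => q j / s dm); exists (s dm)^-1.
  split=> [d|j _].
    rewrite (eq_bigr (fun j => r j d * q j / s dm)); last by move=> *; rewrite mulrA.
    by rewrite -mulr_suml ler_pdivrMr // mul1r; apply: dmP.
  by rewrite mulrAC -/(m j) /q mulVKf // mulf_neq0 ?gt_eqF.
move=> y' l [le1 lE].
have yE j : j \in S -> y' j = q j * l.
  move=> jS; rewrite -(lE j jS) /q -/(m j) [w j * _ * _]mulrAC mulKf //.
  by rewrite mulf_neq0 ?gt_eqF.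
rewrite -[leRHS]mul1r ler_pdivlMr // mulrC.
apply: le_trans (le1 dm); rewrite /s mulr_suml le_eqVlt; apply/orP; left.
by apply/eqP/eq_bigr => j jS; rewrite yE // mulrA.
Qed.

(* Main.v *)
Require Import Defs.
From mathcomp Require Import all_boot all_order all_algebra.
From mathcomp Require Import reals exp.

Set Implicit Arguments.
Unset Strict Implicit.
Unset Printing Implicit Defensive.

Import Order.TTheory GRing.Theory Num.Theory.

Local Open Scope ring_scope.

(* Serve every job in every resource according to its current ideal share
   alone: round the share up to a power of 1/2, but not below 2^-L ~ 1/n, and
   divide by 3. The rounding at most doubles a share or else costs at most 1/n
   per job, so the rounded shares sum to at most 3. By monotonicity the exponent
   of the rounded share of a job only grows, so each job is disrupted at most
   L = O(log n) times in each resource. *)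

(** * Rounding of a single share *)

Section Rounding.
Variable R : realType.
Implicit Types (L : nat) (x y : R).

(** [find] returns the length [L] when no index passes the test, so every share of at most [2^-L]
    gets level [L]; this implements the floor. *)
Definition share_level L x : nat :=
  find (fun i : nat => 2^-1 ^+ i.+1 < x) (iota 0 L).

Definition rounded_share L x : R := 2^-1 ^+ share_level L x.

Lemma share_level_max L x : (share_level L x <= L)%N.
Proof. by rewrite -[leqRHS](size_iota 0); exact: find_size. Qed.

Lemma share_level_anti L x y :
  x <= y -> (share_level L y <= share_level L x)%N.
Proof. by move=> xy; apply: sub_find => i /= /lt_le_trans; apply. Qed.

Lemma rounded_share_ge0 L x : 0 <= rounded_share L x.
Proof. by rewrite exprn_ge0 // invr_ge0. Qed.

Lemma rounded_share_lower L x : x <= 1 -> x <= rounded_share L x.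
Proof.
rewrite /rounded_share => x1; case kE: (share_level L x) => [|k] //.
have kL : (k < L)%N by rewrite -kE share_level_max.
have : (k < share_level L x)%N by rewrite kE.
by move/(before_find 0%N); rewrite nth_iota // add0n => /negbT; rewrite -leNgt.
Qed.

(** At level [L] the floor term alone suffices; at a lower level the test succeeded there, so half
    of the rounded share is below [x]. *)
Lemma rounded_share_upper L x :
  0 <= x -> rounded_share L x <= 2 * x + 2^-1 ^+ L.
Proof.
rewrite /rounded_share => x0.
have := share_level_max L x; rewrite leq_eqVlt => /predU1P[->|kL].
  by rewrite lerDr mulr_ge0.
apply: ler_wpDr; first by rewrite exprn_ge0 // invr_ge0.
have : has (fun i : nat => 2^-1 ^+ i.+1 < x) (iota 0 L).
  by rewrite has_find size_iota.
move/(nth_find 0%N); rewrite -/(share_level L x) nth_iota // add0n exprS.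
by rewrite ltr_pdivrMl // => /ltW.
Qed.

Lemma sum_rounded_share (T : finType) (S : {set T}) (f : T -> R) L :
  (#|T| <= 2 ^ L)%N -> (forall j, j \in S -> 0 <= f j) ->
  \sum_(j in S) f j <= 1 -> \sum_(j in S) rounded_share L (f j) <= 3.
Proof.
move=> TL f0 f1.
apply: (@le_trans _ _ (\sum_(j in S) (2 * f j + 2^-1 ^+ L))).
  by apply: ler_sum => j /f0; exact: rounded_share_upper.
(* The bound 3 splits as 2 for the doubled shares and 1 for at most [2^L] floors of size [2^-L]. *)
rewrite big_split /= -mulr_sumr sumr_const (natrD R 2 1) lerD //.
  by rewrite -[leRHS]mulr1 ler_pM2l.
  rewrite exprVn -[leLHS]mulr_natl ler_pdivrMr ?exprn_gt0 // mul1r -natrX ler_nat.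
exact: leq_trans (max_card _) TL.
Qed.

(** For [n >= 2], rounding up the logarithm gives [2^(up_log 2 n) <= 2n <= n^2], whence the factor
    2; for [n = 1] both sides vanish. *)
Lemma up_log2_ln (n : nat) : (0 < n)%N ->
  (up_log 2 n)%:R <= 2 / ln 2 * ln n%:R :> R.
Proof.
case: n => [//|[_|n _]]; first by rewrite up_log1 ln1 mulr0.
have ln2_gt0 : 0 < ln (2 : R) by rewrite ln_gt0 ?ltr1n.
rewrite mulrAC ler_pdivlMr //.
have : (2 ^ up_log 2 n.+2 <= n.+2 ^ 2)%N.
  have /andP[+ _] := @up_log_bounds 2 n.+2 isT isT.
  case: (up_log _ _) => [//|k] /= /ltnW kn.
  by rewrite expnS -mulnn leq_mul.
rewrite -(ler_nat R) !natrX -ler_ln ?posrE ?exprn_gt0 ?ltr0n //.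
by rewrite !lnXn ?ltr0n // -[ln 2 *+ _]mulr_natl -[ln _ *+ 2]mulr_natl.
Qed.

End Rounding.

(** * The rounding policy and its guarantees *)

Lemma alive_subset (n : nat) (N : alive_sets n) (t : nat) :
  arrival_only N -> (0 < t <= n)%N -> N t.-1 \subset N t.
Proof. by move=> [_ arr] /arr[j [_ ->]]; exact: subsetUr. Qed.

Lemma monotone_shares_alive (R : realType) (n D : nat) (N : alive_sets n)
    (I : shares R n D) (t : nat) (j : 'I_n) (d : 'I_D) :
  arrival_only N -> monotone_shares N I -> (0 < t <= n)%N -> j \in N t.-1 ->
  I t j d <= I t.-1 j d.
Proof.
move=> Narr Imon tn jt; have [i iarr] := Narr.2 _ tn; apply: (Imon _ _ i) => //.
rewrite in_setD1 (subsetP (alive_subset Narr tn)) // andbT.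
by apply: contraTneq jt => ->; exact: iarr.1.
Qed.

Definition rounding_policy (R : realType) (n D : nat) : policy R n D :=
  fun _ I t j d => rounded_share (up_log 2 n) (I t j d) / 3.

Lemma rounding_policy_online (R : realType) (n D : nat) :
  online (@rounding_policy R n D).
Proof.
move=> N N' I I' t /andP[t0 _] eqNI j d jt; rewrite /rounding_policy.
by have [_ ->] := eqNI t (introT andP (conj t0 (leqnn t))).
Qed.

(* The level of an alive job (0 before its arrival) is nondecreasing in time, at
   most L, and grows at each disruption. *)
Lemma rounding_policy_disruptions (R : realType) (n D : nat)
    (N : alive_sets n) (I : shares R n D) :
  arrival_only N -> monotone_shares N I ->
  (disruptions N (rounding_policy N I) <= n * D * up_log 2 n)%N.
Proof.
move=> Narr Imon; set L := up_log 2 n.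
pose phi (jd : 'I_n * 'I_D) t :=
  if jd.1 \in N t then share_level L (I t jd.1 jd.2) else 0%N.
have phi_mono jd t : (0 < t <= n)%N -> (phi jd t.-1 <= phi jd t)%N.
  move=> tn; rewrite /phi; case: ifP => // jt.
  rewrite (subsetP (alive_subset Narr tn)) //.
  by apply: share_level_anti; exact: (monotone_shares_alive _ Narr).
have step jd t : (0 < t <= n)%N ->
    (((jd.1 \in N t.-1 :&: N t) && (rounding_policy N I t jd.1 jd.2 !=
        rounding_policy N I t.-1 jd.1 jd.2)) + phi jd t.-1 <= phi jd t)%N.
  move=> tn; case: andP => [[]|_]; last exact: phi_mono.
  rewrite inE => /andP[jt' jt] ne; rewrite add1n ltn_neqAle phi_mono // andbT.
  (* Equal levels give equal allocations, so a disruption forces strict growth. *)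
  apply: contraNneq ne; rewrite /phi jt jt' /rounding_policy /rounded_share.
  by rewrite -/L => ->.
rewrite /disruptions.
under eq_bigr do rewrite -sum1_card big_mkcond /=.
(* Count per pair of job and resource: each pair is to contribute at most [L]. *)
rewrite exchange_big /=.
have -> : (n * D * L = \sum_(jd : 'I_n * 'I_D) L)%N.
  by rewrite sum_nat_const card_prod !card_ord.
apply: leq_sum => jd _.
have tele m : (m <= n)%N ->
    (\sum_(1 <= t < m.+1) (if jd \in [set jd : 'I_n * 'I_D |
       (jd.1 \in N t.-1 :&: N t) && (rounding_policy N I t jd.1 jd.2 !=
        rounding_policy N I t.-1 jd.1 jd.2)] then 1 else 0) <= phi jd m)%N.
  elim: m => [|m IH] mn; first by rewrite big_geq.
  rewrite big_nat_recr //= addnC; apply: leq_trans (step jd m.+1 mn).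
  by rewrite leq_add ?IH ?(ltnW mn) // inE; case: (_ && _).
apply: leq_trans (tele n (leqnn n)) _.
by rewrite /phi; case: ifP => // _; exact: share_level_max.
Qed.

Lemma rounding_policy_guarantees (R : realType) (n D : nat)
    (N : alive_sets n) (I : shares R n D) :
  (0 < n)%N -> arrival_only N -> feasible N I -> monotone_shares N I ->
  guarantees 3 (2 / ln 2) N I (rounding_policy N I).
Proof.
move=> n0 Narr Ifeas Imon; split.
- move=> t /Ifeas[I0 I1]; split=> [j d _|d].
    by rewrite divr_ge0 // rounded_share_ge0.
  rewrite -mulr_suml ler_pdivrMr // mul1r.
  apply: sum_rounded_share => //; first by rewrite card_ord up_logP.
  by move=> j /I0.
- move=> d t j tn jt; rewrite ler_pM2r ?invr_gt0 //.
  (* A single ideal share is at most the total, hence at most 1, as the lower bound on rounding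
     requires. *)
  have [I0 /(_ d)] := Ifeas t tn.
  rewrite (bigD1 j) //= => I1; apply: rounded_share_lower.
  apply: le_trans I1; rewrite lerDl; apply: sumr_ge0 => i /andP[it _].
  exact: I0.
- have := rounding_policy_disruptions Narr Imon.
  rewrite -(ler_nat R) => /le_trans; apply.
  have -> : 2 / ln 2 * n%:R * D%:R * ln n%:R
          = (n * D)%:R * (2 / ln 2 * ln n%:R) :> R.
    by rewrite natrM -[_ * n%:R * _]mulrA mulrAC mulrC.
  by rewrite natrM ler_wpM2l // up_log2_ln.
Qed.

(** * Feasibility and monotonicity of the weighted DRF shares *)

Section DominantResourceFairness.
Variables (R : realType) (n D : nat).
Variables (w : 'I_n -> R) (r : 'I_n -> 'I_D -> R).
Hypothesis w_gt0 : forall j, 0 < w j.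
Hypothesis r_ge0 : forall j d, 0 <= r j d.
Hypothesis r_neq0 : forall j, exists d, r j d != 0.
Implicit Types (S : {set 'I_n}) (y : 'I_n -> R).

Lemma max_requirement_gt0 j : 0 < \big[Num.max/0]_(d < D) r j d.
Proof.
have [d rd] := r_neq0 j; apply: (@lt_le_trans _ _ (r j d)).
  by rewrite lt_neqAle eq_sym rd r_ge0.
by rewrite (bigD1 d) //= le_max lexx.
Qed.

Lemma drf_rateE S y lambda j : drf_level w r S y lambda -> j \in S ->
  y j = lambda / (w j * \big[Num.max/0]_(d < D) r j d).
Proof.
move=> [_ yE] /yE <-; rewrite [w j * y j * _]mulrAC [_ * y j]mulrC mulfK //.
by rewrite mulf_neq0 ?gt_eqF ?max_requirement_gt0.
Qed.

(** Zero rates are a competitor at level 0, so the optimal level is nonnegative. *)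
Lemma drf_rate_ge0 S y j : weighted_drf w r S y -> j \in S -> 0 <= y j.
Proof.
move=> [lambda lev lmax] jS; rewrite (drf_rateE lev jS).
apply: divr_ge0; last by rewrite mulr_ge0 // ltW // max_requirement_gt0.
apply: (lmax (fun=> 0)); split=> [d|i _]; last by rewrite mulr0 mul0r.
by rewrite big1 // => i _; rewrite mulr0.
Qed.

(* The rates of the larger set are a competitor for the smaller one, so the
   water level can only drop. *)
Lemma drf_rate_anti S S' y y' j : S \subset S' ->
  weighted_drf w r S y -> weighted_drf w r S' y' -> j \in S -> y' j <= y j.
Proof.
move=> SS' [l lev lmax] drf' jS; have y'0 i := @drf_rate_ge0 S' y' i drf'.
have [l' lev' _] := drf'.
rewrite (drf_rateE lev jS) (drf_rateE lev' (subsetP SS' _ jS)).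
rewrite ler_pM2r ?invr_gt0 ?mulr_gt0 ?max_requirement_gt0 //.
apply: (lmax y'); split=> [d|i iS]; last exact: lev'.2 (subsetP SS' _ iS).
(* Dropping the jobs outside [S] only lowers consumption, their rates being nonnegative. *)
apply: le_trans (lev'.1 d); rewrite [leRHS](big_setID S) /=.
rewrite (setIidPr SS') lerDl; apply: sumr_ge0 => i.
by rewrite inE => /andP[_ iS']; rewrite mulr_ge0 ?y'0.
Qed.

Variables (N : alive_sets n) (y : nat -> 'I_n -> R).
Hypothesis drf_y :
  forall t : nat, (0 < t <= n)%N -> weighted_drf w r (N t) (y t).

Lemma drf_shares_feasible : feasible N (drf_shares r y).
Proof.
move=> t tn; split=> [j d jt|d].
  by rewrite mulr_ge0 // (drf_rate_ge0 (drf_y tn)).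
by have [l [le1 _] _] := drf_y tn; exact: le1.
Qed.

Lemma drf_shares_monotone :
  arrival_only N -> monotone_shares N (drf_shares r y).
Proof.
move=> Narr d t j tn [_ Nt] i; rewrite Nt in_setD1 in_setU1.
case/andP=> /negPf-> /= it; rewrite /drf_shares ler_wpM2l //.
(* At time 1 there is no earlier job; from time 2 on, [drf_y] covers both the current and the
   previous time. *)
case: t => [//|[|t]] in tn Nt it *; first by rewrite /= Narr.1 inE in it.
apply: (drf_rate_anti (alive_subset Narr tn)) it; first exact/drf_y/ltnW.
exact: drf_y.
Qed.

End DominantResourceFairness.

Theorem mainTheorem7 (R : realType) :
  exists c C : R, 1 <= c /\ 0 < C /\
    forall D n : nat, (1 <= D)%N -> (1 <= n)%N ->
      exists P : policy R n D,
        [/\ online P,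
            (forall (N : alive_sets n) (I : shares R n D),
               arrival_only N -> feasible N I -> monotone_shares N I ->
               guarantees c C N I (P N I))
          & (forall (N : alive_sets n) (w : 'I_n -> R) (r : 'I_n -> 'I_D -> R)
                    (y : nat -> 'I_n -> R),
               arrival_only N ->
               (forall j : 'I_n, 0 < w j) ->
               (forall (j : 'I_n) (d : 'I_D), 0 <= r j d) ->
               (forall j : 'I_n, exists d : 'I_D, r j d != 0) ->
               (forall t : nat, (0 < t <= n)%N ->
                  weighted_drf w r (N t) (y t)) ->
               [/\ feasible N (drf_shares r y),
                   monotone_shares N (drf_shares r y)
                 & guarantees c C N (drf_shares r y)
                     (P N (drf_shares r y))])].
Proof.
(* [3] is the divisor that restores feasibility after rounding; [2 / ln 2] converts [up_log 2 n]
   into [ln n]. *)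
exists 3, (2 / ln 2); split; first by rewrite ler1n.
split; first by rewrite divr_gt0 // ln_gt0 ?ltr1n.
move=> D n _ n0; exists (@rounding_policy R n D); split.
- exact: rounding_policy_online.
- by move=> N I; exact: rounding_policy_guarantees.
- move=> N w r y Narr w0 r0 rN0 drf_y.
  have feas := drf_shares_feasible w0 r0 rN0 drf_y.
  have mono := drf_shares_monotone w0 r0 rN0 drf_y Narr.
  by split=> //; exact: rounding_policy_guarantees.
Qed.
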